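(* Let $a,b,c\in R^{WD}$ commute with each other (that is, $ab=ba$, $ac=ca$, $bc=cb$), and let $a^{WD}$, $b^{WD}$, $c^{WD}$ be WD inverses of $a,b,c$ respectively. If $cc^{WD}b=bcc^{WD}$ and $c^{WD}b^{WD}a=ac^{WD}b^{WD}$, then $abc$ is WD invertible and $c^{WD}b^{WD}a^{WD}$ is a WD inverse of $abc$, i.e. $(abc)^{WD}=c^{WD}b^{WD}a^{WD}$.
   Context: $R$ is a proper unital ring with involution: an associative ring with $1$ and a map $*:R\to R$ with $(a+b)^*=a^*+b^*$, $(ab)^*=b^*a^*$, $(a^* )^*=a$, such that $a^*a=0$ implies $a=0$. Weak Drazin (WD) inverse: $a\in R$ is WD invertible if there are $x\in R$ and a positive integer $k$ with $axa=a$, $a^{k+1}x=a^k$, $xa^{k+1}=a^k$. The least positive integer $k$ for which such an $x$ exists is the weak Drazin index $\mathrm{ind}(a)$; any $x$ satisfying the three equations with $k=\mathrm{ind}(a)$ is a WD inverse of $a$ (not unique in general), denoted $a^{WD}$. $R^{WD}$ is the set of WD invertible elements. *)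

(* Defs.v *)
From mathcomp Require Import all_boot all_algebra.

Set Implicit Arguments.
Unset Strict Implicit.
Unset Printing Implicit Defensive.

Import GRing.Theory.
Local Open Scope ring_scope.

Section WeakDrazin.
Variable R : pzRingType.
Implicit Types (a x : R) (k : nat) (star : R -> R).

Definition is_involution star : Prop :=
  [/\ forall a b, star (a + b) = star a + star b,
      forall a b, star (a * b) = star b * star a
    & involutive star].

Definition proper_involution star : Prop :=
  is_involution star /\ forall a, star a * a = 0 -> a = 0.

Definition WD_eqs k a x : Prop :=
  [/\ a * x * a = a, a ^+ k.+1 * x = a ^+ k & x * a ^+ k.+1 = a ^+ k].

Definition WD_invertible a : Prop :=
  exists x, exists2 k, (0 < k)%N & WD_eqs k a x.

(* A relation rather than a function, so that no index has to be assigned to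
   elements that are not WD invertible. *)
Definition is_WD_index a k : Prop :=
  [/\ (0 < k)%N, exists x, WD_eqs k a x
    & forall m, (0 < m)%N -> (exists x, WD_eqs m a x) -> (k <= m)%N].

Definition is_WD_inverse a x : Prop :=
  exists2 k, is_WD_index a k & WD_eqs k a x.

End WeakDrazin.

(* Main.v *)
(** Let [x], [y], [z] be the given WD inverses of [a], [b], [c]. For [m] large,
    the two power equations for [zyx] follow by commuting the powers of [a],
    [b], [c] past each other. The inner-inverse equation is
    [abc zyx abc = bc(azy)xabc = (bcz)y(axa)bc = czbyb ca = (czc)ba = abc].
    Finally, if some element satisfies the equations for [a] with exponent [k],
    then every element satisfying them with a larger exponent also does with
    [k]; hence an element satisfying them for some exponent is a WD inverse. *)
Require Import Defs.
From mathcomp Require Import all_boot all_algebra.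

Import GRing.Theory.
Local Open Scope ring_scope.

Section WeakDrazinTheory.
Context {R : pzRingType}.
Implicit Types (a b c x y z : R) (k m n : nat).

Lemma WD_eqs_widen k m a x : (k <= m)%N -> WD_eqs k a x -> WD_eqs m a x.
Proof.
move=> /subnK <-; case=> axa ax xa; split=> //.
  by rewrite -addnS exprD -mulrA ax -exprD.
by rewrite addnC -addSn exprD mulrA xa -exprD.
Qed.

Lemma WD_eqs_expl k n a x : WD_eqs k a x -> x ^+ n * a ^+ (n + k) = a ^+ k.
Proof.
move=> eqs; elim: n => [|n IHn]; first by rewrite expr0 mul1r.
by have [_ _ xa] := WD_eqs_widen k (n + k) a x (leq_addl n k) eqs;
  rewrite exprSr addSn -mulrA xa.
Qed.

Lemma WD_eqs_expr k n a x : WD_eqs k a x -> a ^+ (n + k) * x ^+ n = a ^+ k.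
Proof.
move=> eqs; elim: n => [|n IHn]; first by rewrite expr0 mulr1.
by have [_ ax _] := WD_eqs_widen k (n + k) a x (leq_addl n k) eqs;
  rewrite exprS addSn mulrA ax.
Qed.

(** With [n = m - k], expanding [a ^+ k.+1] as [x' ^+ n * a ^+ (n + k.+1)] lets the equation for [x]
    at exponent [m] act; [x' ^+ n * a ^+ (n + k)] then collapses to [a ^+ k]. The other side is
    symmetric. *)
Lemma WD_eqs_lower k m a x x' :
  (k <= m)%N -> WD_eqs k a x' -> WD_eqs m a x -> WD_eqs k a x.
Proof.
move=> /subnK <-; move: (m - k)%N => n eqs' [axa ax xa].
have eqsS := WD_eqs_widen k k.+1 a x' (leqnSn k) eqs'.
split=> //.
  by rewrite -(WD_eqs_expl k.+1 n a x' eqsS) addnS -mulrA ax (WD_eqs_expl k n a x').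
by rewrite -(WD_eqs_expr k.+1 n a x' eqsS) addnS mulrA xa (WD_eqs_expr k n a x').
Qed.

Lemma WD_eqs_is_inverse m a x : (0 < m)%N -> WD_eqs m a x -> is_WD_inverse a x.
Proof.
move=> m_gt0 eqs.
(* A boolean form of the equations for the fixed [x], so that a least exponent can be extracted. *)
pose P k := [&& (0 < k)%N, a * x * a == a, a ^+ k.+1 * x == a ^+ k
               & x * a ^+ k.+1 == a ^+ k].
have P_eqs k : WD_eqs k a x -> (0 < k)%N -> P k.
  by case=> axa ax xa k_gt0; rewrite /P k_gt0 axa ax xa !eqxx.
have exP : exists k, P k by exists m; apply: P_eqs.
case: (ex_minnP exP) => k /and4P[k_gt0 /eqP axa /eqP ax /eqP xa] kmin.
exists k; last by [].
split=> //; first by exists x.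
move=> n n_gt0 [x' eqs']; apply: kmin; apply: P_eqs => //.
(* [kmin] is minimality for [x] alone, so the equations of [x'] at [n] must be transferred to [x]:
   by lowering from [m] if [n <= m], by widening otherwise. *)
have [nm|/ltnW mn] := leqP n m; first exact: (WD_eqs_lower n m a x x').
exact: (WD_eqs_widen m n).
Qed.

Lemma WD_eqs_mul3 m a b c x y z :
  a * b = b * a -> a * c = c * a -> b * c = c * b ->
  WD_eqs m a x -> WD_eqs m b y -> WD_eqs m c z ->
  c * z * b = b * c * z -> z * y * a = a * z * y ->
  WD_eqs m (a * b * c) (z * y * x).
Proof.
move=> ab ac bc [axa ax xa] [byb by_ yb] [czc cz zc] h1 h2.
have Xabc n : (a * b * c) ^+ n = a ^+ n * b ^+ n * c ^+ n.
  rewrite exprMn_comm ?exprMn_comm //.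
  by apply: commr_sym; apply: commrM; apply: commr_sym.
have bcX i j : b ^+ i * c ^+ j = c ^+ j * b ^+ i.
  exact/commrX/commr_sym/commrX.
have a_bcX i j k : a ^+ i * (b ^+ j * c ^+ k) = b ^+ j * c ^+ k * a ^+ i.
  by apply: commrM; apply/commrX/commr_sym/commrX.
have abcE : a * b * c = b * c * a by rewrite ab -mulrA ac mulrA.
split; rewrite ?Xabc.
- have -> : a * b * c * (z * y * x) * (a * b * c)
          = b * c * (a * z * y) * x * (a * b * c) by rewrite {1}abcE !mulrA.
  have -> : b * c * (a * z * y) * x * (a * b * c)
          = b * c * z * y * (a * x * a) * (b * c) by rewrite -h2 !mulrA.
  have -> : b * c * z * y * (a * x * a) * (b * c)
          = c * z * (b * y * b) * c * a.
    by rewrite axa -h1 -[LHS]mulrA [a * (b * c)]mulrA abcE !mulrA.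
  by rewrite byb -[c * z * b * c]mulrA bc mulrA czc -bc -abcE.
(* Absorption from the inside out: [z] into the power of [c], then [y] into that of [b], then [x]
   into that of [a], each power being commuted into place first. *)
- have -> : a ^+ m.+1 * b ^+ m.+1 * c ^+ m.+1 * (z * y * x)
          = a ^+ m.+1 * (b ^+ m.+1 * (c ^+ m.+1 * z)) * y * x.
    by rewrite !mulrA.
  rewrite cz bcX.
  have -> : a ^+ m.+1 * (c ^+ m * b ^+ m.+1) * y * x
          = a ^+ m.+1 * (c ^+ m * (b ^+ m.+1 * y)) * x by rewrite !mulrA.
  by rewrite by_ -bcX a_bcX -mulrA ax -a_bcX mulrA.
(* The mirror image: [x] is absorbed first, then [y], then [z]. *)
- have -> : z * y * x * (a ^+ m.+1 * b ^+ m.+1 * c ^+ m.+1)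
          = z * y * (x * a ^+ m.+1 * (b ^+ m.+1 * c ^+ m.+1)).
    by rewrite !mulrA.
  rewrite xa a_bcX.
  have -> : z * y * (b ^+ m.+1 * c ^+ m.+1 * a ^+ m)
          = z * ((y * b ^+ m.+1) * c ^+ m.+1) * a ^+ m by rewrite !mulrA.
  by rewrite yb bcX mulrA zc -bcX -a_bcX mulrA.
Qed.

End WeakDrazinTheory.

Theorem theorem3p5 (R : pzRingType) (star : R -> R)
    (hstar : proper_involution star)
    (a b c : R)
    (ha : WD_invertible a) (hb : WD_invertible b) (hc : WD_invertible c)
    (hab : a * b = b * a) (hac : a * c = c * a) (hbc : b * c = c * b)
    (aWD bWD cWD : R)
    (haWD : is_WD_inverse a aWD)
    (hbWD : is_WD_inverse b bWD)
    (hcWD : is_WD_inverse c cWD)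
    (h1 : c * cWD * b = b * c * cWD)
    (h2 : cWD * bWD * a = a * cWD * bWD) :
  WD_invertible (a * b * c) /\
  is_WD_inverse (a * b * c) (cWD * bWD * aWD).
Proof.
have [ka [ka_gt0 _ _] eqa] := haWD.
have [[kb _ eqb] [kc _ eqc]] := (hbWD, hcWD).
(* A common exponent, to which all three systems of equations widen. *)
set m := maxn ka (maxn kb kc).
have m_gt0 : (0 < m)%N by rewrite leq_max ka_gt0.
have eqs : WD_eqs m (a * b * c) (cWD * bWD * aWD).
  apply: WD_eqs_mul3 => //.
  - by apply: WD_eqs_widen eqa; rewrite leq_maxl.
  - by apply: WD_eqs_widen eqb; rewrite !leq_max leqnn orbT.
  - by apply: WD_eqs_widen eqc; rewrite !leq_max leqnn !orbT.
split; last exact: WD_eqs_is_inverse eqs.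
by exists (cWD * bWD * aWD), m.
Qed.
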